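(* Let $\gamma$ be the size of a string attractor for a string $S$ of length $n$ over an alphabet of size $\sigma$. Then, for every $2\le\tau\le n/\gamma$, there is a data structure of size $O(\tau\sigma\gamma\log_\tau(n/\gamma))$ words supporting select queries on $S$ in $O(\log_\tau(n/\gamma))$ time.
   Context: A string attractor of $S\in\Sigma^n$ is a set $\Gamma\subseteq[1..n]$ such that every substring $S[i..j]$ has an occurrence $S[i'..j']=S[i..j]$ with some $j''\in\Gamma\cap[i'..j']$. $S.select_c(i)$ is the position of the $i$-th occurrence of symbol $c$ in $S$. Model: word RAM with words of $\Theta(\log n)$ bits. *)

(* Defs.v *)
From mathcomp Require Import all_boot all_order all_algebra.
From mathcomp Require Import all_classical all_reals all_analysis.
Set Implicit Arguments.
Unset Strict Implicit.
Unset Printing Implicit Defensive.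

Import Order.TTheory GRing.Theory Num.Theory.

Local Open Scope nat_scope.

(** Strings of length [n] over an alphabet of [sigma] symbols are
    [n.-tuple 'I_sigma].  Positions are ordinals, so the ordinal [j] stands for
    the position [j + 1] of [1..n]; the answers of [select] are 1-based. *)

Definition substring (T : Type) (S : seq T) (i j : nat) : seq T :=
  drop i (take j.+1 S).

Definition string_attractor (n sigma : nat) (S : n.-tuple 'I_sigma)
    (Gamma : {set 'I_n}) : Prop :=
  forall i j : 'I_n, i <= j ->
  exists i' j' : 'I_n,
    [/\ i' <= j', substring S i' j' = substring S i j
      & exists2 k : 'I_n, k \in Gamma & i' <= k <= j'].

(** Meaningful for [0 < i <= count_mem c S] only. *)
Definition select (n sigma : nat) (S : n.-tuple 'I_sigma) (c : 'I_sigma)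
    (i : nat) : nat :=
  nth 0 [seq (val k).+1 | k <- enum 'I_n & tnth S k == c] i.-1.

(** Word RAM.  A word is a natural number below [2 ^ w].  A machine has
    registers (a program names only finitely many of them) and a memory of
    [size mem] words, which is accessed by computed addresses. *)

Inductive binop :=
  | Add | Sub | Mul | Div | Mod | And | Or | Xor | Shl | Shr | CmpEq | CmpLt.

Definition eval_binop (w : nat) (o : binop) (x y : nat) : nat :=
  match o with
  | Add => (x + y) %% 2 ^ w
  | Sub => (x + 2 ^ w - y) %% 2 ^ w
  | Mul => (x * y) %% 2 ^ w
  | Div => x %/ y
  | Mod => x %% y
  | And => Nat.land x y
  | Or => Nat.lor x y
  | Xor => Nat.lxor x y
  | Shl => (x * 2 ^ y) %% 2 ^ w
  | Shr => x %/ 2 ^ y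
  | CmpEq => x == y
  | CmpLt => x < y
  end.

Inductive instr :=
  | Const (r k : nat)              (* r <- k *)
  | Move (r s : nat)               (* r <- s *)
  | Op (o : binop) (r s t : nat)   (* r <- s o t *)
  | Read (r s : nat)               (* r <- mem[s] *)
  | Write (r s : nat)              (* mem[s] <- r *)
  | Jump (l : nat)
  | JumpZ (r l : nat)              (* if r = 0 then goto l *)
  | Halt.

Definition program := seq instr.

Record state := State { pc : nat; regs : nat -> nat; mem : seq nat }.

Definition set_reg (f : nat -> nat) (r x : nat) : nat -> nat :=
  fun s => if s == r then x else f s.

(** [None] is a fault: a memory access out of bounds, or a program counter
    outside of the program. *)
Definition step (w : nat) (P : program) (s : state) : option state :=
  let: State p f m := s in
  match onth P p with
  | None => None
  | Some (Const r k) => Some (State p.+1 (set_reg f r (k %% 2 ^ w)) m)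
  | Some (Move r a) => Some (State p.+1 (set_reg f r (f a)) m)
  | Some (Op o r a b) =>
      Some (State p.+1 (set_reg f r (eval_binop w o (f a) (f b))) m)
  | Some (Read r a) =>
      if f a < size m then Some (State p.+1 (set_reg f r (nth 0 m (f a))) m)
      else None
  | Some (Write r a) =>
      if f a < size m then Some (State p.+1 f (set_nth 0 m (f a) (f r)))
      else None
  | Some (Jump l) => Some (State l f m)
  | Some (JumpZ r l) => Some (State (if f r == 0 then l else p.+1) f m)
  | Some Halt => Some s
  end.

Definition halted (P : program) (s : state) : Prop := onth P (pc s) = Some Halt.

(** Registers 0, 1, ... hold the arguments of the query, all other registers
    hold 0. *)
Definition query_state (D : seq nat) (args : seq nat) : state :=
  State 0 (nth 0 args) D.

(** On memory [D], the query [args] stops after at most [t] steps with [ans] in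
    register 0.  The memory [D] includes any working space, and it has to be
    left as it was found, so that queries can be repeated. *)
Definition answers (w : nat) (P : program) (D args : seq nat) (t ans : nat)
    : Prop :=
  exists s : state,
    [/\ iter t (obind (step w P)) (Some (query_state D args)) = Some s,
        halted P s, regs s 0 = ans & mem s = D].

(** The number of bits needed to write a length or position up to [n] and a
    symbol below [sigma]; it is Theta(log n) when [sigma] is polynomial in
    [n]. *)
Definition input_bits (n sigma : nat) : nat := (trunc_log 2 (maxn n sigma)).+1.

Definition is_memory (w : nat) (D : seq nat) : bool :=
  all (fun x => x < 2 ^ w) D.

Definition logb (R : realType) (b x : R) : R := (ln x / ln b)%R.

(* Main.v *)
(**
  For each symbol [c], a block tree is built over the ranks of the occurrences
  of [c] instead of over the positions of [S], so that select becomes random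
  access and needs no predecessor search.  With [k = floor tau], the cells of
  level [l] hold [k ^ (h - l)] consecutive occurrences, where [h] is least with
  [n <= gamma * k ^ h]; at level 0, [gamma] cells cover everything.  A cell is a
  substring from an occurrence of [c] to another, so it has a copy through an
  attractor position [j], and the ranks in the copy are close to the rank of
  [j].  Hence on the next level the copy lies in a window of [2 * k] cells
  around [j].  A cell stores the address of this window, the offset of the copy
  in it and the distance from the copy to the cell.  A query descends one level
  in O(1) time and adds up the distances; the cells of level [h], of one
  occurrence each, store its position.
*)
Require Import Defs.
From mathcomp Require Import all_boot all_order all_algebra.
From mathcomp Require Import all_classical all_reals all_analysis.
From mathcomp Require Import zify lra.
Import Order.TTheory GRing.Theory Num.Theory.
Set Implicit Arguments.
Unset Strict Implicit.
Unset Printing Implicit Defensive.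
Local Open Scope nat_scope.

(** * Ranks and positions of the occurrences of a symbol *)

(** Position [x] itself is excluded, so the rank of an occurrence is its 0-based index in [occ]. *)
Definition rank (T : eqType) (c : T) (s : seq T) (x : nat) : nat :=
  count_mem c (take x s).

Definition occ (T : eqType) (c : T) (s : seq T) : seq nat :=
  [seq x <- iota 0 (size s) | nth c s x == c].

Lemma rank_mono (T : eqType) (c : T) (s : seq T) (x y : nat) :
  x <= y -> rank c s x <= rank c s y.
Proof.
move=> xy; rewrite /rank -(subnKC xy) takeD count_cat; exact: leq_addr.
Qed.

Lemma rankS (T : eqType) (c : T) (s : seq T) (x : nat) :
  x < size s -> rank c s x.+1 = rank c s x + (nth c s x == c).
Proof.
by move=> xs; rewrite /rank (take_nth c xs) -cats1 count_cat /= addn0.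
Qed.

Lemma rankD (T : eqType) (c : T) (s : seq T) (x d : nat) :
  rank c s (x + d) = rank c s x + rank c (drop x s) d.
Proof. by rewrite /rank takeD count_cat. Qed.

Lemma size_filter_iota (T : eqType) (c : T) (s : seq T) (x : nat) :
  x <= size s ->
  size [seq y <- iota 0 x | nth c s y == c] = rank c s x.
Proof.
elim: x => [|x IH] xs; first by rewrite /rank take0.
by rewrite -addn1 iotaD filter_cat size_cat IH ?(ltnW xs)// addn1 rankS//= fun_if.
Qed.

Lemma size_occ (T : eqType) (c : T) (s : seq T) : size (occ c s) = count_mem c s.
Proof. by rewrite /occ size_filter_iota// /rank take_size. Qed.

(** Splitting [iota] at [x] leaves exactly [rank c s x] entries of [occ] before [x]. *)
Lemma nth_occ_rank (T : eqType) (c : T) (s : seq T) (x : nat) :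
  x < size s -> nth c s x = c ->
  rank c s x < size (occ c s) /\ nth 0 (occ c s) (rank c s x) = x.
Proof.
move=> xs sx.
have E : occ c s = [seq y <- iota 0 x | nth c s y == c] ++
    x :: [seq y <- iota x.+1 (size s - x.+1) | nth c s y == c].
  rewrite /occ -{1}(subnKC (ltnW xs)) iotaD filter_cat add0n.
  by rewrite -(subnSK xs) /= sx eqxx.
split.
  by rewrite E size_cat size_filter_iota ?(ltnW xs)//=; lia.
by rewrite E nth_cat size_filter_iota ?(ltnW xs)// ltnn subnn.
Qed.

Lemma nth_occP (T : eqType) (c : T) (s : seq T) (g : nat) :
  g < size (occ c s) ->
  [/\ nth 0 (occ c s) g < size s, nth c s (nth 0 (occ c s) g) = c
    & rank c s (nth 0 (occ c s) g) = g].
Proof.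
move=> gs; have := mem_nth 0 gs; set x := nth 0 _ g.
rewrite mem_filter mem_iota add0n => /andP[/eqP sx /andP[_ xs]].
have [rs xE] := nth_occ_rank xs sx.
split=> //; apply/eqP; rewrite -(nth_uniq 0 rs gs) ?xE//.
by rewrite filter_uniq// iota_uniq.
Qed.

Lemma nth_occ_mono (T : eqType) (c : T) (s : seq T) (g g' : nat) :
  g <= g' -> g' < size (occ c s) -> nth 0 (occ c s) g <= nth 0 (occ c s) g'.
Proof.
move=> gg' g's.
have [xs sx rx] := nth_occP (leq_ltn_trans gg' g's).
have [ys sy ry] := nth_occP g's.
rewrite leqNgt; apply/negP => /(@rank_mono _ c s).
by rewrite rankS// sy eqxx rx ry; lia.
Qed.

Lemma select_occ (n sigma : nat) (S : n.-tuple 'I_sigma) (c : 'I_sigma) (i : nat) :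
  0 < i <= count_mem c S -> select S c i = (nth 0 (occ c S) i.-1).+1.
Proof.
case/andP=> i0 im.
have E : occ c S = [seq val k | k <- enum 'I_n & tnth S k == c].
  rewrite /occ size_tuple -val_enum_ord filter_map; congr map.
  by apply: eq_filter => k /=; rewrite (tnth_nth c).
have Em : [seq (val k).+1 | k <- enum 'I_n & tnth S k == c] = map succn (occ c S).
  by rewrite E -map_comp.
by rewrite /select Em (nth_map 0)// size_occ; lia.
Qed.

(** * Copies of runs of occurrences through attractor positions *)

Lemma size_substring (T : Type) (s : seq T) (x y : nat) :
  y < size s -> size (substring s x y) = y.+1 - x.
Proof. by move=> ys; rewrite /substring size_drop size_takel. Qed.

Lemma take_substring (T : Type) (s : seq T) (x y d : nat) :
  x + d <= y.+1 -> take d (substring s x y) = take d (drop x s).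
Proof.
move=> xd; rewrite /substring !take_drop -take_min (minn_idPl _)//.
by rewrite addnC.
Qed.

(* The ranks [a], ..., [a + s - 1] of [c] span a substring of [S]; its copy
   through an attractor position [j] consists of the ranks [a'], ...,
   [a' + s - 1], hence [a'] is within distance [s] of the rank of [j]. *)
Lemma occ_copy (n sigma : nat) (S : n.-tuple 'I_sigma) (Gamma : {set 'I_n})
    (c : 'I_sigma) (a s : nat) :
  string_attractor S Gamma -> 0 < s -> a < size (occ c S) ->
  exists (j : 'I_n) (a' : nat),
    [/\ j \in Gamma, a' <= rank c S j < a' + s
      & forall i, i < s -> a + i < size (occ c S) ->
        a' + i < size (occ c S) /\
        nth 0 (occ c S) (a' + i) + nth 0 (occ c S) a =
        nth 0 (occ c S) a' + nth 0 (occ c S) (a + i)].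
Proof.
move=> attr s0 am.
(* The last rank of the run is [e], cut off at [m] because the final run may be incomplete. *)
set m := size (occ c S) in am *; set e := minn (a + s) m - 1.
have ae : a <= e by rewrite /e; lia.
have em : e < m by rewrite /e; lia.
have [xs sx rx] := nth_occP am.
have [ys sy ry] := nth_occP em.
have xy := nth_occ_mono ae em.
set x := nth 0 _ a in xs sx rx xy *; set y := nth 0 _ e in ys sy ry xy.
have xn : x < n by rewrite size_tuple in xs.
have yn : y < n by rewrite size_tuple in ys.
have [x' [y' [x'y' Esub [j jG /andP[x'j jy']]]]] :=
  attr (Ordinal xn) (Ordinal yn) xy.
rewrite /= in Esub.
have y's : y' < size S by rewrite size_tuple.
have Elen : y' - x' = y - x.
  have := congr1 size Esub; rewrite !size_substring//; lia.
have Hrank d : d <= y.+1 - x -> rank c S (x' + d) = rank c S x' + (rank c S (x + d) - a).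
  move=> dle; rewrite !rankD rx addKn /rank; congr (_ + count _ _).
  rewrite -(@take_substring _ S x y d); last by lia.
  by rewrite -Esub take_substring//; lia.
have Hnth d : d <= y - x -> nth c S (x' + d) = nth c S (x + d).
  move=> dle; have := congr1 (fun s => nth c s d) Esub.
  by rewrite /substring !nth_drop !nth_take//; lia.
have Hocc i : a + i <= e ->
    rank c S x' + i < m /\ nth 0 (occ c S) (rank c S x' + i) = x' + (nth 0 (occ c S) (a + i) - x).
  move=> aie; have aim : a + i < m by lia.
  have [zs sz rz] := nth_occP aim.
  have xz := nth_occ_mono (leq_addr i a) aim.
  have zy := nth_occ_mono aie em.
  rewrite -/x -/y in xz zy; move: xz zy zs sz rz; set z := nth 0 _ (a + i) => xz zy zs sz rz.
  have Ez : x + (z - x) = z by lia.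
  have dle : z - x <= y - x by lia.
  have := Hrank (z - x); rewrite Ez rz addKn => <-; last by lia.
  apply: nth_occ_rank; last by rewrite Hnth ?Ez.
  by apply: leq_ltn_trans y's; lia.
(* The copy starts at an occurrence of [c], so its first rank is that of [x']. The rank of [y']
   exceeds it by [e - a < s], which bounds the rank of [j]. *)
exists j, (rank c S x'); split=> //.
  rewrite rank_mono//=; apply: (@leq_ltn_trans (rank c S y')).
    exact: rank_mono.
  have -> : val y' = x' + (y - x) by rewrite -Elen subnKC.
  by rewrite Hrank; [rewrite subnKC// ry; lia|lia].
move=> i si aim.
have aie : a + i <= e by rewrite /e; lia.
have [H1 H2] := Hocc _ aie.
have [|_ H3] := Hocc 0; first by rewrite addn0.
rewrite !addn0 -/x subnn addn0 in H3.
split=> //; rewrite H2 H3.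
have := nth_occ_mono (leq_addr i a) aim; rewrite -/x; lia.
Qed.

(** * The query program and its symbolic execution *)

(* Addresses 0, 1, 2 hold [k ^ h], [k] and the number of words per symbol of
   level 0; the cells, of three words each, start at address 3.  In the loop
   (instructions 9 to 25), register 0 is the address of a window, 1 the rank in
   this window, 4 the length of its cells, 5 is [k] and 7 accumulates the
   answer. *)
Definition select_program : program :=
  [:: Const 2 1; Op Defs.Sub 1 1 2; Read 4 3; Read 5 2; Const 3 2; Read 6 3;
      Op Mul 0 0 6; Const 3 3; Op Add 0 0 3;
      Op Div 6 1 4; Op Mod 1 1 4; Op Mul 6 6 3; Op Add 6 6 0; Read 8 6;
      Op Add 7 7 8; Op CmpEq 9 4 2; JumpZ 9 19; Move 0 7; Halt;
      Op Add 6 6 2; Read 0 6; Op Add 6 6 2; Read 8 6; Op Add 1 1 8;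
      Op Div 4 4 5; Jump 9].

Definition run (w t : nat) (s : state) : option state :=
  iter t (obind (step w select_program)) (Some s).

Arguments run : simpl never.

(** Symbolic execution peels off the first instruction, whereas [iter] exposes the last one. *)
Lemma runS (w t : nat) (s : state) :
  run w t.+1 s = if step w select_program s is Some s' then run w t s' else None.
Proof.
rewrite /run iterSr /=; case: (step _ _ _) => //.
by elim: t => //= t ->.
Qed.

Lemma run_add (w t u : nat) (s s' : state) :
  run w t s = Some s' -> run w (t + u) s = run w u s'.
Proof. by move=> E; rewrite /run addnC iterD -/(run w t s) E. Qed.

(** Loop invariant at instruction 9; registers 6, 8 and 9 are scratch and stay unconstrained. *)
Definition at_loop (f : nat -> nat) (k base i s acc : nat) : Prop :=
  [/\ f 0 = base, f 1 = i & f 2 = 1] /\ [/\ f 3 = 3, f 4 = s, f 5 = k & f 7 = acc].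

(** One loop iteration reads the three words of the cell at [a]: distance, next window, offset. The
    bounds prevent overflow everywhere except in the accumulator, which is meant modulo [2 ^ w]. *)
Lemma run_descend (w : nat) (D : seq nat) (f : nat -> nat)
    (k base i s acc a : nat) :
  at_loop f k base i s acc -> s != 1 ->
  a = 3 * (i %/ s) + base -> a.+2 < size D -> size D < 2 ^ w ->
  i %% s + nth 0 D a.+2 < 2 ^ w ->
  exists2 f', run w 15 (State 9 f D) = Some (State 9 f' D)
    & at_loop f' k (nth 0 D a.+1) (i %% s + nth 0 D a.+2) (s %/ k)
        ((acc + nth 0 D a) %% 2 ^ w).
Proof.
move=> [[f0 f1 f2] [f3 f4 f5 f7]] s1 aE aD Dw iw.
have Dw0 : 0 < size D by lia.
have E1 : ((f 1 %/ f 4 * f 3) %% 2 ^ w + f 0) %% 2 ^ w = a.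
  rewrite f0 f1 f3 f4 modnDml mulnC -aE modn_small//; lia.
have E2 : (a + 1) %% 2 ^ w = a.+1 by rewrite modn_small; lia.
have E3 : (a.+1 + 1) %% 2 ^ w = a.+2 by rewrite modn_small; lia.
have aD1 : a.+1 < size D by lia.
have aD0 : a < size D by lia.
eexists.
  do 5 (rewrite runS /= /set_reg /=); rewrite E1 aD0 /=.
  do 8 (rewrite runS /= /set_reg /= ?E1 ?f4 ?(negbTE s1) ?f2 ?E2 ?E3 ?aD1 ?aD /=).
  do 2 (rewrite runS /= /set_reg /=).
  reflexivity.
split; split; rewrite /set_reg /= ?E1 ?f2 ?E2 ?E3 ?f3 ?f4 ?f5 ?f7 //.
by rewrite f1 modn_small.
Qed.

Lemma run_leaf (w : nat) (D : seq nat) (f : nat -> nat)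
    (k base i acc a : nat) :
  at_loop f k base i 1 acc ->
  a = 3 * i + base -> a < size D -> size D < 2 ^ w ->
  exists2 s, run w 9 (State 9 f D) = Some s
    & [/\ halted select_program s, regs s 0 = (acc + nth 0 D a) %% 2 ^ w
        & Defs.mem s = D].
Proof.
move=> [[f0 f1 f2] [f3 f4 f5 f7]] aE aD Dw.
have E1 : ((f 1 %/ f 4 * f 3) %% 2 ^ w + f 0) %% 2 ^ w = a.
  rewrite f0 f1 f3 f4 divn1 modnDml mulnC -aE modn_small//; lia.
eexists.
  do 5 (rewrite runS /= /set_reg /=); rewrite E1 aD /=.
  do 4 (rewrite runS /= /set_reg /= ?f4 ?f2 /=).
  reflexivity.
by split=> //=; rewrite /set_reg /= ?E1 f7.
Qed.

Lemma run_init (w : nat) (D : seq nat) (c i : nat) :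
  0 < i -> i < 2 ^ w -> 3 < size D -> size D < 2 ^ w ->
  3 + c * nth 0 D 2 < size D ->
  exists2 f, run w 9 (query_state D [:: c; i]) = Some (State 9 f D)
    & at_loop f (nth 0 D 1) (3 + c * nth 0 D 2) i.-1 (nth 0 D 0) 0.
Proof.
move=> i0 iw D3 Dw cD.
have m1 : 1 %% 2 ^ w = 1 by rewrite modn_small; lia.
have m2 : 2 %% 2 ^ w = 2 by rewrite modn_small; lia.
have m3 : 3 %% 2 ^ w = 3 by rewrite modn_small; lia.
have [D0 D1 D2] : [/\ 0 < size D, 1 < size D & 2 < size D] by split; lia.
eexists.
  do 9 (rewrite runS /= /set_reg /= ?m1 ?m2 ?m3 ?D0 ?D1 ?D2 /=).
  reflexivity.
split; split; rewrite /set_reg //=.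
- by rewrite modnDml modn_small addnC//; lia.
- rewrite (_ : i + 2 ^ w - 1 = i.-1 + 2 ^ w); last by lia.
  by rewrite modnDr modn_small; lia.
Qed.

(** * Layout of the memory as a table *)

Lemma table_layout (L sigma W w : nat) (header : nat -> nat)
    (word : nat -> 'I_sigma -> nat -> nat -> nat) :
  0 < sigma ->
  exists D : seq nat,
    [/\ is_memory w D, size D = 3 + 3 * (L * sigma * W),
        forall f, f < 3 -> nth 0 D f = header f %% 2 ^ w
      & forall l (c : 'I_sigma) x f, l < L -> x < W -> f < 3 ->
          nth 0 D (3 + 3 * ((l * sigma + c) * W + x) + f) =
          word l c x f %% 2 ^ w].
Proof.
move=> sigma0; pose c0 := Ordinal sigma0.
(* An address is a mixed-radix numeral with digits level, symbol, cell and word, recovered by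
   division with remainder. *)
pose entry a := if a < 3 then header a else
  let y := (a - 3) %/ 3 in
  word (y %/ W %/ sigma) (insubd c0 (y %/ W %% sigma)) (y %% W) ((a - 3) %% 3).
exists (mkseq (fun a => entry a %% 2 ^ w) (3 + 3 * (L * sigma * W))); split.
- by apply/allP => _ /mapP[a _ ->]; rewrite ltn_pmod// expn_gt0.
- by rewrite size_mkseq.
- by move=> f f3; rewrite nth_mkseq /entry ?f3//; lia.
move=> l c x f lL xW f3.
have cs := ltn_ord c.
have lcL : l * sigma + c < L * sigma.
  by rewrite (leq_trans (n := l.+1 * sigma)) ?leq_mul2r ?lL ?orbT// mulSn; lia.
have yle : (l * sigma + c) * W + x < L * sigma * W.
  by rewrite (leq_trans (n := (l * sigma + c).+1 * W)) ?leq_mul2r ?lcL ?orbT// mulSn; lia.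
rewrite nth_mkseq; last by lia.
have entryE y : entry (3 + 3 * y + f) =
    word (y %/ W %/ sigma) (insubd c0 (y %/ W %% sigma)) (y %% W) f.
  rewrite /entry -addnA ltnNge leq_addr [~~ true]/=.
  by rewrite addKn mulnC divnMDl// (divn_small f3) addn0 modnMDl (modn_small f3).
rewrite entryE divnMDl ?(leq_ltn_trans _ xW)// (divn_small xW) addn0.
by rewrite divnMDl// (divn_small cs) addn0 !modnMDl (modn_small xW) (modn_small cs) valKd.
Qed.

(** * Contents of the table and correctness of the queries *)

(** Here [j] is an index into [enum Gamma], not a position, so that windows are numbered from 0. *)
Definition attractor_rank (n sigma : nat) (S : n.-tuple 'I_sigma)
    (Gamma : {set 'I_n}) (c : 'I_sigma) (j : nat) : nat :=
  rank c S (nth 0 (map val (enum Gamma)) j).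

(** Choosing the copies by a function lets the table entries be defined explicitly. *)
Lemma copy_choice (n sigma : nat) (S : n.-tuple 'I_sigma) (Gamma : {set 'I_n}) :
  string_attractor S Gamma ->
  exists copy : 'I_sigma * nat * nat -> nat * nat, forall c s a,
    0 < s -> a < size (occ c S) ->
    let: (j, a') := copy (c, s, a) in
    [/\ j < #|Gamma|, a' <= attractor_rank S Gamma c j < a' + s
      & forall i, i < s -> a + i < size (occ c S) ->
        a' + i < size (occ c S) /\
        nth 0 (occ c S) (a' + i) + nth 0 (occ c S) a =
        nth 0 (occ c S) a' + nth 0 (occ c S) (a + i)].
Proof.
move=> attr.
have H (q : 'I_sigma * nat * nat) : exists ja : nat * nat,
    0 < q.1.2 -> q.2 < size (occ q.1.1 S) ->
    [/\ ja.1 < #|Gamma|,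
        ja.2 <= attractor_rank S Gamma q.1.1 ja.1 < ja.2 + q.1.2
      & forall i, i < q.1.2 -> q.2 + i < size (occ q.1.1 S) ->
        ja.2 + i < size (occ q.1.1 S) /\
        nth 0 (occ q.1.1 S) (ja.2 + i) + nth 0 (occ q.1.1 S) q.2 =
        nth 0 (occ q.1.1 S) ja.2 + nth 0 (occ q.1.1 S) (q.2 + i)].
  case: q => -[c s] a /=.
  have [/andP[s0 am]|nsa] := boolP ((0 < s) && (a < size (occ c S))); last first.
    by exists (0, 0) => s0 am; rewrite s0 am in nsa.
  have [j [a' [jG ja' Ha']]] := occ_copy attr s0 am.
  exists (index j (enum Gamma), a') => _ _ /=.
  have jG' : j \in enum Gamma by rewrite mem_enum.
  have jlt : index j (enum Gamma) < size (enum Gamma) by rewrite index_mem.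
  split=> //; first by rewrite cardE.
  by rewrite /attractor_rank (nth_map j)// nth_index.
have [copy Hcopy] := choice H.
exists copy => c s a s0 am; have := Hcopy (c, s, a) s0 am.
by case: (copy _).
Qed.

Lemma select_structure (n sigma : nat) (S : n.-tuple 'I_sigma)
    (Gamma : {set 'I_n}) (k h w : nat) :
  string_attractor S Gamma -> 0 < sigma -> 0 < #|Gamma| -> 1 < k ->
  n <= #|Gamma| * k ^ h -> n < 2 ^ w -> 2 * k ^ h < 2 ^ w ->
  3 + 3 * (h.+1 * sigma * (#|Gamma| * (2 * k))) < 2 ^ w ->
  exists D : seq nat,
    [/\ is_memory w D, size D = 3 + 3 * (h.+1 * sigma * (#|Gamma| * (2 * k)))
      & forall (c : 'I_sigma) (i : nat), 0 < i <= count_mem c S ->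
        answers w select_program D [:: val c; i] (18 + 15 * h) (select S c i)].
Proof.
move=> attr sigma0 Gamma0 k1 nk nw khw Nw.
(* Replacing position [y] by its copy [x] and adding the stored distance changes the sum only by the
   modulus [M]. *)
have shift_pos M acc u v x y : v < M -> x + u = v + y ->
    acc + (u + M - v + x.+1) = acc + y.+1 + M by lia.
have [copy Hcopy] := copy_choice attr.
set W := #|Gamma| * (2 * k) in Nw *.
have kd0 d : 0 < k ^ d by rewrite expn_gt0; lia.
have k2 : 0 < 2 * k by lia.
(* Truncated subtraction: a window that would start below rank 0 starts at 0,
   and still contains the ranks within distance [k ^ (h - l)] of the center. *)
pose window l c j := attractor_rank S Gamma c j - k ^ (h - l).
(* The least rank in the cell. After level 0, quotient and remainder of [x] by [2 * k] give the
   attractor index and the place in its window. *)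
pose cell l c x :=
  if l is l'.+1 then window l' c (x %/ (2 * k)) + (x %% (2 * k)) * k ^ (h - l)
  else x * k ^ h.
(* Distances are stored modulo [2 ^ w], since the copy may lie after the cell. *)
pose word l (c : 'I_sigma) x f :=
  let p := occ c S in
  let g := cell l c x in
  (* The successor makes answers 1-based. Cells past the last occurrence hold fillers; no query
     visits them. *)
  if l == h then (nth 0 p g).+1 else
  if g < size p then
    let: (j, a') := copy (c, k ^ (h - l), g) in
    match f with
    | 0 => nth 0 p g + 2 ^ w - nth 0 p a'
    | 1 => 3 + 3 * ((l.+1 * sigma + c) * W + j * (2 * k))
    | _ => a' - window l c j
    end
  else 0.
pose header f := nth 0 [:: k ^ h; k; 3 * W] f.
have [D [Dmem Dsize Dheader Dword]] := table_layout h.+1 W w header word sigma0.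
exists D; split=> // c i /andP[i0 im].
rewrite select_occ ?i0//.
set p := occ c S; have msz : size p = count_mem c S by exact: size_occ.
have mn : size p <= n by rewrite msz (leq_trans (count_size _ _))// size_tuple.
have pn g : g < size p -> nth 0 p g < n.
  by case/nth_occP; rewrite size_tuple.
set ans := (nth 0 p i.-1).+1.
have answ : ans < 2 ^ w by apply: leq_ltn_trans nw; apply: pn; lia.
have addr_lt l (b : 'I_sigma) x : l < h.+1 -> x < W ->
    3 + 3 * ((l * sigma + b) * W + x) + 2 < size D.
  move=> lL xW; have bs := ltn_ord b; rewrite Dsize.
  have lbL : l * sigma + b < h.+1 * sigma.
    by rewrite (leq_trans (n := l.+1 * sigma)) ?leq_mul2r ?lL ?orbT// mulSn; lia.
  suff : (l * sigma + b) * W + x < h.+1 * sigma * W by lia.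
  by rewrite (leq_trans (n := (l * sigma + b).+1 * W)) ?leq_mul2r ?lbL ?orbT// mulSn; lia.
have Dw : size D < 2 ^ w by rewrite Dsize.
(* Invariant of the descent, with [d] levels to go: accumulator plus 1-based position of the current
   rank is the answer modulo [2 ^ w]. *)
have main d l x0 r acc f : l + d = h ->
  at_loop f k (3 + 3 * ((l * sigma + c) * W + x0)) r (k ^ d) acc ->
  x0 + r %/ k ^ d < W ->
  cell l c (x0 + r %/ k ^ d) + r %% k ^ d < size p ->
  acc + (nth 0 p (cell l c (x0 + r %/ k ^ d) + r %% k ^ d)).+1 = ans %[mod 2 ^ w] ->
  exists2 s, run w (15 * d + 9) (State 9 f D) = Some s
    & [/\ halted select_program s, regs s 0 = ans & Defs.mem s = D].
  elim: d l x0 r acc f => [|d IH] l x0 r acc f lh.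
    have {}lh : l = h by lia.
    subst l; rewrite expn0 divn1 modn1 addn0 => Hf xW gm Hacc.
    pose a := 3 + 3 * ((h * sigma + c) * W + (x0 + r)).
    have Da : nth 0 D a = (nth 0 p (cell h c (x0 + r))).+1 %% 2 ^ w.
      by rewrite -[a]addn0 Dword// /word eqxx.
    have aD := addr_lt _ c _ (ltnSn h) xW.
    have aE : a = 3 * r + (3 + 3 * ((h * sigma + c) * W + x0)) by rewrite /a; lia.
    have aD' : a < size D by rewrite /a; lia.
    have [s Hs [s1 s2 s3]] := run_leaf Hf aE aD' Dw.
    exists s => //; split=> //.
    by rewrite s2 Da modnDmr Hacc modn_small.
  move=> Hf; set q := r %/ _; set r' := r %% _ => xW gm Hacc.
  have r'k : r' < k ^ d.+1 by rewrite ltn_pmod.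
  have lh' : l != h by lia.
  have lk : h - l = d.+1 by lia.
  have lk' : h - l.+1 = d by lia.
  have lL : l < h.+1 by lia.
  have lL' : l.+1 < h.+1 by lia.
  have aD := addr_lt _ c _ lL xW.
  have kdh : k ^ d.+1 <= k ^ h by rewrite leq_exp2l//; lia.
  set g := cell l c (x0 + q) in gm Hacc.
  have gm' : g < size p by lia.
  have := Hcopy c (k ^ d.+1) g (kd0 _) gm'.
  case E : (copy _) => [j a'] [jG aj Ha'].
  pose a := 3 + 3 * ((l * sigma + c) * W + (x0 + q)).
  pose base := 3 + 3 * ((l.+1 * sigma + c) * W + j * (2 * k)).
  pose o := a' - window l c j.
  have /andP[a'r ra'] := aj.
  have a'o : window l c j + o = a'.
    by rewrite /o /window lk subnKC// leq_subLR addnC ltnW.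
  have ok : o <= k ^ d.+1.
    rewrite /o /window lk leq_subLR; apply: leq_trans a'r _.
    by rewrite addnC -leq_subLR.
  (* This is why [2 * k] cells of length [k ^ d] suffice for a window. *)
  have r'o : r' + o < 2 * k ^ d.+1 by rewrite mul2n -addnn -addSn leq_add.
  have r'ow : r' + o < 2 ^ w.
    by apply: leq_trans r'o (leq_trans _ (ltnW khw)); rewrite leq_mul2l kdh orbT.
  have ow : o < 2 ^ w by exact: leq_ltn_trans (leq_addl r' o) r'ow.
  have jW m : m < 2 * k -> j * (2 * k) + m < W.
    move=> mk; apply: (@leq_trans (j.+1 * (2 * k))); first by rewrite mulSn addnC ltn_add2r.
    by rewrite leq_mul2r jG orbT.
  have baseD : base < 2 ^ w.
    have jW0 := jW 0 k2; rewrite addn0 in jW0.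
    apply: leq_trans (ltnW Dw); apply: leq_ltn_trans (addr_lt _ c _ lL' jW0).
    exact: leq_addr.
  have wordE b : word l c (x0 + q) b =
      match b with
      | 0 => nth 0 p g + 2 ^ w - nth 0 p a'
      | 1 => base
      | _ => o
      end.
    by rewrite /word (negbTE lh') -/p -/g gm' lk E.
  have D0 : nth 0 D a = (nth 0 p g + 2 ^ w - nth 0 p a') %% 2 ^ w.
    by rewrite -[a]addn0 Dword// wordE.
  have D1 : nth 0 D a.+1 = base.
    by rewrite -[a.+1]addn1 Dword// wordE modn_small.
  have D2 : nth 0 D a.+2 = o.
    by rewrite -[a.+2]addn2 Dword// wordE modn_small.
  have k1d : k ^ d.+1 != 1 by rewrite neq_ltn -{2}(exp1n d.+1) ltn_exp2r ?k1 ?orbT.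
  have aE : a = 3 * q + (3 + 3 * ((l * sigma + c) * W + x0)) by rewrite /a; lia.
  have aD' : a.+2 < size D by rewrite /a; lia.
  have iw : r' + nth 0 D a.+2 < 2 ^ w by rewrite D2.
  have [f' Hrun Hf'] := run_descend Hf k1d aE aD' Dw iw.
  rewrite D0 D1 D2 -/r' expnS mulKn in Hf'; last by lia.
  have [r'm Hpos] := Ha' _ r'k gm.
  have qk : (r' + o) %/ k ^ d < 2 * k.
    by rewrite ltn_divLR// -mulnA -expnS.
  have cellE : cell l.+1 c (j * (2 * k) + (r' + o) %/ k ^ d) + (r' + o) %% k ^ d = a' + r'.
    rewrite /cell lk' divnMDl//.
    rewrite (divn_small qk) addn0 modnMDl (modn_small qk) -addnA -divn_eq.
    by rewrite addnCA a'o addnC.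
  suff [s Hs Hs'] : exists2 s, run w (15 * d + 9) (State 9 f' D) = Some s
      & [/\ halted select_program s, regs s 0 = ans & Defs.mem s = D].
    by exists s => //; rewrite mulnS -addnA (run_add _ Hrun).
  apply: IH Hf' _ _ _; [by rewrite addSnnS|exact: jW|by rewrite cellE|].
  rewrite cellE -Hacc modnDml -addnA addnCA modnDml -[RHS]modnDr.
  have a'n : nth 0 p a' < 2 ^ w.
    by apply: leq_trans (ltnW nw); apply: pn; exact: leq_ltn_trans (leq_addr _ _) r'm.
  by rewrite addnCA (shift_pos _ acc _ _ _ _ a'n Hpos).
have c_lt := ltn_ord c.
have WN : 3 * W < 2 ^ w.
  apply: leq_ltn_trans Nw; apply: leq_trans (leq_addl _ _).
  by rewrite leq_mul2l leq_pmull// muln_gt0.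
have kW : k <= W.
  by rewrite /W mulnA leq_pmull// muln_gt0 Gamma0.
have GW : #|Gamma| <= W by rewrite leq_pmulr.
have D2E : nth 0 D 2 = 3 * W by rewrite Dheader// modn_small.
have D1E : nth 0 D 1 = k.
  rewrite Dheader// modn_small//; apply: leq_ltn_trans WN; apply: leq_trans kW _.
  exact: leq_pmull.
have D0E : nth 0 D 0 = k ^ h.
  by rewrite Dheader// modn_small//; apply: leq_ltn_trans khw; exact: leq_pmull.
have im' : i.-1 < size p by rewrite msz prednK.
(* By the choice of [h], the first [#|Gamma|] cells of level 0 cover all ranks. *)
have qG : i.-1 %/ k ^ h < #|Gamma|.
  by rewrite ltn_divLR//; exact: leq_trans im' (leq_trans mn nk).
have qW : i.-1 %/ k ^ h < W by exact: leq_trans qG GW.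
have aD := addr_lt 0 c 0 (ltn0Sn h) (leq_ltn_trans (leq0n _) qW).
have iw : i < 2 ^ w.
  by apply: leq_ltn_trans nw; rewrite -msz in im; exact: leq_trans im mn.
have D3 : 3 < size D by exact: leq_ltn_trans (leq_trans (leq_addr _ _) (leq_addr _ _)) aD.
have cD : 3 + c * nth 0 D 2 < size D.
  by rewrite D2E mulnCA; apply: leq_ltn_trans aD; rewrite mul0n add0n addn0 leq_addr.
have [f Hrun Hf] := run_init i0 iw D3 Dw cD.
have cellE : cell 0 c (0 + i.-1 %/ k ^ h) + i.-1 %% k ^ h = i.-1.
  by rewrite /cell add0n -divn_eq.
have {}Hf : at_loop f k (3 + 3 * ((0 * sigma + c) * W + 0)) i.-1 (k ^ h) 0.
  by rewrite D0E D1E D2E in Hf; rewrite addn0 mul0n add0n mulnCA.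
have [s Hs [s1 s2 s3]] : exists2 s, run w (15 * h + 9) (State 9 f D) = Some s
    & [/\ halted select_program s, regs s 0 = ans & Defs.mem s = D].
  by apply: main Hf _ _ _; rewrite ?cellE ?add0n.
exists s; split=> //; rewrite (_ : 18 + 15 * h = 9 + (15 * h + 9)); last by lia.
by rewrite -/(run _ _ _) (run_add _ Hrun).
Qed.

(** * Bounds on the word size and on the depth *)

(** With [X = 2 ^ input_bits n sigma], the factors [h.+2], [sigma] and [gamma * k] are at most [X],
    so all quantities are at most [3 + 6 * X ^ 3 < X ^ 8]. *)
Lemma word_size_bounds (n sigma gamma k h w : nat) :
  0 < gamma -> 0 < sigma -> 1 < k -> gamma * k <= n -> gamma * k ^ h < n ->
  8 * input_bits n sigma <= w ->
  [/\ n < 2 ^ w, 2 * k ^ h.+1 < 2 ^ w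
    & 3 + 3 * (h.+2 * sigma * (gamma * (2 * k))) < 2 ^ w].
Proof.
move=> gamma0 sigma0 k1 gk gkh bw.
set X := 2 ^ input_bits n sigma.
have Xw : X ^ 8 <= 2 ^ w by rewrite /X -expnM leq_exp2l// mulnC.
have maxX : maxn n sigma < X by exact: trunc_log_ltn.
have [nX sX] : n < X /\ sigma < X by move: maxX; rewrite gtn_max => /andP.
have kn : k <= n by apply: leq_trans gk; rewrite leq_pmull.
have khn : k ^ h < n by apply: leq_ltn_trans gkh; rewrite leq_pmull.
have hn : h.+2 <= X.
  by apply: leq_trans nX; rewrite ltnS (leq_trans _ khn)// ltnS ltnW// ltn_expl.
have X3 : 3 <= X by apply: leq_trans nX; rewrite ltnS (leq_trans k1).
have X8 m : m <= 3 + 6 * X ^ 3 -> m < 2 ^ w.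
  move=> mX; apply: leq_trans Xw; apply: leq_ltn_trans mX _.
  have X0 : 27 <= X ^ 3 by rewrite -[27]/(3 ^ 3) leq_exp2r.
  have -> : X ^ 8 = X ^ 3 * X ^ 3 * (X * X) by rewrite -[X * X]/(X ^ 2) -!expnD.
  have X1 : 9 <= X * X by rewrite (leq_mul X3 X3).
  have := leq_mul X0 (leqnn (X ^ 3)); have := leq_mul (leqnn (X ^ 3 * X ^ 3)) X1; lia.
have XX : X <= X ^ 3 by rewrite -{1}(expn1 X) leq_exp2l; lia.
have XX2 : X * X <= X ^ 3 by rewrite mulnn leq_exp2l; lia.
split; apply: X8.
- lia.
- by have := leq_mul (leq_trans kn (ltnW nX)) (leq_trans (ltnW khn) (ltnW nX)); rewrite expnS; lia.
have : h.+2 * sigma * (gamma * k) <= X * X * X.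
  by rewrite !leq_mul// ?(ltnW sX)// (leq_trans gk)// ltnW.
rewrite -(mulnA X) -[X * (X * X)]/(X ^ 3) (mulnCA gamma) (mulnCA _ 2); lia.
Qed.

Local Open Scope ring_scope.

(** Rounding [tau] down to [k] at most doubles the depth: [tau < k + 1 <= k ^ 2], hence
    [ln tau <= 2 * ln k]. *)
Lemma log_depth (R : realType) (tau x : R) (k h : nat) :
  2 <= tau -> tau <= x -> k%:R <= tau -> tau < k.+1%:R -> (1 < k)%N ->
  k%:R ^+ h <= x ->
  1 <= logb tau x /\ h%:R <= 2 * logb tau x.
Proof.
move=> tau2 taux ktau tauk k1 kx.
have tau0 : 0 < tau by lra.
have x0 : 0 < x by lra.
have lntau : 0 < ln tau by rewrite ln_gt0//; lra.
have k0 : 0 < k%:R :> R by rewrite ltr0n; lia.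
split.
  by rewrite /logb ler_pdivlMr// mul1r ler_ln.
have tau_k2 : ln tau <= 2 * ln k%:R.
  rewrite mulr_natl -lnXn// ler_ln ?posrE ?exprn_gt0//.
  apply: le_trans (ltW tauk) _; rewrite -natrX ler_nat; nia.
have h_ln : h%:R * ln k%:R <= ln x :> R.
  by rewrite mulr_natl -lnXn// ler_ln ?posrE ?exprn_gt0.
rewrite /logb mulrA ler_pdivlMr//.
have : h%:R * ln tau <= h%:R * (2 * ln k%:R) by rewrite ler_wpM2l.
lra.
Qed.

(** * Choice of the parameters and final estimates *)

Theorem theorem21 :
  exists (K C : nat) (P : program), (0 < K)%N /\
  forall (R : realType) (n sigma gamma : nat) (S : n.-tuple 'I_sigma)
    (Gamma : {set 'I_n}) (tau : R) (w : nat),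
  string_attractor S Gamma -> #|Gamma| = gamma ->
  2 <= tau -> tau <= n%:R / gamma%:R ->
  (K * input_bits n sigma <= w)%N ->
  exists D : seq nat,
    [/\ is_memory w D,
        (size D)%:R <=
          C%:R * (tau * sigma%:R * gamma%:R * logb tau (n%:R / gamma%:R))
      & forall (c : 'I_sigma) (i : nat), (0 < i <= count_mem c S)%N ->
        exists2 t : nat,
          t%:R <= C%:R * logb tau (n%:R / gamma%:R)
        & answers w P D [:: val c; i] t (select S c i)].
Proof.
(* With depth [h.+1], [1 <= lam] and [h <= 2 * lam], the time is [33 + 15 * h <= 63 * lam]; the size
   is at most [3 + 24 * lam * T <= 27 * lam * T]. *)
exists 8%N, 63%N, select_program; split=> // R n sigma gamma S Gamma tau w.
move=> attr Gammag tau2 taun bw.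
have gamma0 : (0 < gamma)%N.
  (* Division by 0 gives 0, which contradicts [2 <= tau]. *)
  by case: gamma {Gammag} taun => // ; rewrite invr0 mulr0; lra.
have g0 : 0 < gamma%:R :> R by rewrite ltr0n.
have tau0 : 0 <= tau by lra.
have tg : tau * gamma%:R <= n%:R by rewrite -ler_pdivlMr.
set k := Num.trunc tau.
have /andP[ktau tauk] := truncn_itv tau0.
have k1 : (1 < k)%N by rewrite /k truncn_ge_nat.
have gk : (gamma * k <= n)%N.
  rewrite -(ler_nat R) natrM mulrC; apply: le_trans tg.
  by rewrite ler_wpM2r// ltW.
have ex_depth : exists h, (n <= gamma * k ^ h)%N.
  by exists n; apply: leq_trans (ltnW (ltn_expl n k1)) _; rewrite leq_pmull.
(* Depth 0 would give [n <= gamma], against [gamma * k <= n]. Hence the least depth is [h.+1], and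
   [gamma * k ^ h < n] by minimality. *)
case: (ex_minnP ex_depth) => -[|h] nk hmin.
  by move: nk; rewrite expn0 muln1; nia.
have gkh : (gamma * k ^ h < n)%N.
  by rewrite ltnNge; apply/negP => /hmin; rewrite ltnn.
have n0 : (0 < n)%N by apply: leq_ltn_trans gkh.
have sigma0 : (0 < sigma)%N.
  by apply: leq_ltn_trans (ltn_ord (tnth S (Ordinal n0))).
have [nw khw Nw] := word_size_bounds gamma0 sigma0 k1 gk gkh bw.
rewrite -Gammag in gamma0 nk Nw.
have [D [Dmem Dsize Dans]] := select_structure attr sigma0 gamma0 k1 nk nw khw Nw.
set lam := logb tau (n%:R / gamma%:R).
have [lam1 hlam] : 1 <= lam /\ h%:R <= 2 * lam.
  apply: (@log_depth _ tau _ k) => //.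
  by rewrite ler_pdivlMr// -natrX -natrM ler_nat mulnC ltnW.
exists D; split=> //; last first.
  move=> c i ci; exists (18 + 15 * h.+1)%N; last exact: Dans.
  rewrite natrD natrM -natr1; lra.
rewrite Dsize Gammag.
rewrite (_ : (3 + 3 * (h.+2 * sigma * (gamma * (2 * k))))%N
    = (3 + 6 * (h.+2 * (k * sigma * gamma)))%N); last by lia.
rewrite natrD !natrM.
have sg1 : 1 <= sigma%:R * gamma%:R :> R.
  by rewrite -natrM ler1n muln_gt0 sigma0 -Gammag.
have ksg : k%:R * sigma%:R * gamma%:R <= tau * sigma%:R * gamma%:R.
  by rewrite -!mulrA ler_wpM2r// mulr_ge0.
set T := tau * _ * _ in ksg *.
have T1 : 1 <= T by rewrite /T -mulrA; nra.
have h4 : h.+2%:R <= 4 * lam by rewrite -addn2 natrD; lra.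
have : h.+2%:R * (k%:R * sigma%:R * gamma%:R) <= 4 * lam * T.
  by rewrite ler_pM// !mulr_ge0.
nra.
Qed.
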